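(* Let $\mathcal{P} \subseteq \mathbb{C}^{n_p}$, let $\mu$ be a measure over $\mathcal{P}$, let $H \in L_2(\mathcal{P}, \mu; \mathbb{C}^{n_o \times n_i})$, and let $\hat\alpha_i, \hat\beta_j, \hat\gamma_k \colon \mathcal{P} \to \mathbb{C}$ ($i = 1, \dots, q_A$; $j = 1, \dots, q_B$; $k = 1, \dots, q_C$) be measurable functions satisfying $$\int_{\mathcal{P}} \left( \frac{\sum_{j=1}^{q_B} |\hat\beta_j(p)| \, \sum_{k=1}^{q_C} |\hat\gamma_k(p)|}{\sum_{i=1}^{q_A} |\hat\alpha_i(p)|} \right)^{2} d\mu(p) < \infty .$$ Let $\Sigma_{\mathrm{St}}$ be the set of all tuples $(\hat A_i, \hat B_j, \hat C_k)$ with $\hat A_i \in \mathbb{C}^{r \times r}$, $\hat B_j \in \mathbb{C}^{r \times n_i}$, $\hat C_k \in \mathbb{C}^{n_o \times r}$ such that $$\operatorname*{ess\,sup}_{p \in \mathcal{P}} \left\| \hat\alpha_i(p) \hat{\mathcal{A}}(p)^{-1} \right\|_F < \infty, \quad i = 1, 2, \dots, q_A .$$ Then for any $(\hat A_i, \hat B_j, \hat C_k) \in \Sigma_{\mathrm{St}}$ the gradients of $$\mathcal{J}(\hat A_i, \hat B_j, \hat C_k) = \int_{\mathcal{P}} \| H(p) - \hat H(p) \|_F^2 \, d\mu(p)$$ are $$\nabla_{\overline{\hat A_i}} \mathcal{J} = \int_{\mathcal{P}} \overline{\hat\alpha_i(p)} \, \hat X_d(p) \bigl( H(p) - \hat H(p)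 \bigr) \hat X(p)^* \, d\mu(p), \quad i = 1, \dots, q_A,$$ $$\nabla_{\overline{\hat B_j}} \mathcal{J} = \int_{\mathcal{P}} \overline{\hat\beta_j(p)} \, \hat X_d(p) \bigl( \hat H(p) - H(p) \bigr) \, d\mu(p), \quad j = 1, \dots, q_B,$$ $$\nabla_{\overline{\hat C_k}} \mathcal{J} = \int_{\mathcal{P}} \overline{\hat\gamma_k(p)} \, \bigl( \hat H(p) - H(p) \bigr) \hat X(p)^* \, d\mu(p), \quad k = 1, \dots, q_C.$$
   Context: $n_p, n_o, n_i, r, q_A, q_B, q_C$ are positive integers; $(\cdot)^*$ is the conjugate transpose and $\|\cdot\|_F$ the Frobenius norm. For a tuple $(\hat A_i, \hat B_j, \hat C_k)$ (a structured reduced-order model, StROM) define $$\hat{\mathcal{A}}(p) = \sum_{i=1}^{q_A} \hat\alpha_i(p) \hat A_i, \quad \hat{\mathcal{B}}(p) = \sum_{j=1}^{q_B} \hat\beta_j(p) \hat B_j, \quad \hat{\mathcal{C}}(p) = \sum_{k=1}^{q_C} \hat\gamma_k(p) \hat C_k,$$ the reduced state $\hat X(p) = \hat{\mathcal{A}}(p)^{-1} \hat{\mathcal{B}}(p)$, the output $\hat H(p) = \hat{\mathcal{C}}(p) \hat X(p)$, and the dual reduced state $\hat X_d(p) = \hat{\mathcal{A}}(p)^{-*} \hat{\mathcal{C}}(p)^*$. Gradients are Wirtinger gradients: a real-valued function $f$ of a complex matrix $X$ is Wirtinger differentiable at $X$ with gradients $\nabla_X f$, $\nabla_{\overline X} f$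 if $$f(X + \Delta X) = f(X) + \langle \nabla_X f(X), \overline{\Delta X} \rangle_F + \langle \nabla_{\overline X} f(X), \Delta X \rangle_F + o(\|\Delta X\|),$$ where $\langle Y, Z \rangle_F = \sum_{i,j} Y_{ij} \overline{Z_{ij}}$. Equivalently, entrywise, $(\nabla_{\overline X} f)_{ij} = \partial f / \partial \overline{X_{ij}}$ with $\partial/\partial \overline z = \tfrac12 (\partial/\partial x + \boldsymbol{\imath} \, \partial/\partial y)$ for $z = x + \boldsymbol{\imath} y$, where $\boldsymbol{\imath}$ is the imaginary unit. *)

(* Defs.v *)
From HB Require Import structures.
From mathcomp Require Import all_boot all_order all_algebra.
From mathcomp Require Import complex.
From mathcomp Require Import all_classical all_reals all_analysis.
From mathcomp Require Import ess_sup_inf.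

Set Implicit Arguments.
Unset Strict Implicit.
Unset Printing Implicit Defensive.

Import Order.TTheory GRing.Theory Num.Def Num.Theory.
Import numFieldNormedType.Exports.
Import Normc.

Local Open Scope classical_set_scope.
Local Open Scope ring_scope.
Local Open Scope sesquilinear_scope.

(* C^n, under a name of its own so that it can be a pointedType, which
   measurable structures in the library require. *)
Definition cspace (R : realType) (n : nat) : Type := 'cV[R[i]]_n.

HB.instance Definition _ (R : realType) (n : nat) :=
  Choice.on (cspace R n).
HB.instance Definition _ (R : realType) (n : nat) :=
  isPointed.Build (cspace R n) (0 : 'cV[R[i]]_n).

Section frobenius.
Context {R : realType} {m n : nat}.

Definition frobdot (Y Z : 'M[R[i]]_(m, n)) : R[i] :=
  \sum_(i < m) \sum_(j < n) Y i j * (Z i j)^*.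

(* R-valued, since normc : R[i] -> R; the norm `|_| of R[i] is R[i]-valued. *)
Definition frobnorm (M : 'M[R[i]]_(m, n)) : R :=
  Num.sqrt (\sum_(i < m) \sum_(j < n) normc (M i j) ^+ 2).

End frobenius.

Section wirtinger.
Context {R : realType} {m n : nat}.

(* G is the gradient with respect to X, and Gbar the one with respect to the
   conjugate of X; both are uniquely determined, being the coefficients of the
   C-linear and the antilinear part of the real differential of f at X. *)
Definition wirtinger_gradients (f : 'M[R[i]]_(m, n) -> R)
    (X G Gbar : 'M[R[i]]_(m, n)) : Prop :=
  forall e : R, 0 < e -> exists2 d : R, 0 < d &
    forall D : 'M[R[i]]_(m, n), frobnorm D < d ->
      normc ((f (X + D))%:C%C
             - ((f X)%:C%C + frobdot G (map_mx conjC D) + frobdot Gbar D))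
        <= e * frobnorm D.

Definition is_conj_gradient (f : 'M[R[i]]_(m, n) -> R)
    (X Gbar : 'M[R[i]]_(m, n)) : Prop :=
  exists G : 'M[R[i]]_(m, n), wirtinger_gradients f X G Gbar.

End wirtinger.

Section complex_measure_theory.
Context {R : realType} {d : measure_display} {T : measurableType d}.
Implicit Types (mu : {measure set T -> \bar R}) (D : set T).

Definition cmeasurable_fun D (f : T -> R[i]) : Prop :=
  measurable_fun D (fun x => complex.Re (f x)) /\
  measurable_fun D (fun x => complex.Im (f x)).

Definition cintegral mu D (f : T -> R[i]) : R[i] :=
  Complex (\int[mu]_(x in D) complex.Re (f x))
          (\int[mu]_(x in D) complex.Im (f x)).

Definition mxintegral m n mu D (F : T -> 'M[R[i]]_(m, n)) : 'M[R[i]]_(m, n) :=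
  \matrix_(i < m, j < n) cintegral mu D (fun x => F x i j).

(* A representative of an element of L_2(D, mu; C^(m x n)). *)
Definition mxL2 m n mu D (F : T -> 'M[R[i]]_(m, n)) : Prop :=
  (forall i j, cmeasurable_fun D (fun x => F x i j)) /\
  (\int[mu]_(x in D) (frobnorm (F x) ^+ 2)%:E < +oo)%E.

End complex_measure_theory.

Section strom.
Context {R : realType} {d : measure_display} {T : measurableType d}.
Context {no ni r qA qB qC : nat}.
Variables (mu : {measure set T -> \bar R}) (P : set T).
Variable H : T -> 'M[R[i]]_(no, ni).
Variables (alpha : 'I_qA -> T -> R[i]) (beta : 'I_qB -> T -> R[i]).
Variable gamma : 'I_qC -> T -> R[i].

Definition sepform q m n (c : 'I_q -> T -> R[i]) (M : 'I_q -> 'M[R[i]]_(m, n))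
  (p : T) : 'M[R[i]]_(m, n) := \sum_(i < q) c i p *: M i.

Variables (A : 'I_qA -> 'M[R[i]]_r) (B : 'I_qB -> 'M[R[i]]_(r, ni)).
Variable C : 'I_qC -> 'M[R[i]]_(no, r).

Definition state (p : T) : 'M[R[i]]_(r, ni) :=
  invmx (sepform alpha A p) *m sepform beta B p.

Definition output (p : T) : 'M[R[i]]_(no, ni) :=
  sepform gamma C p *m state p.

Definition dual_state (p : T) : 'M[R[i]]_(r, no) :=
  (invmx (sepform alpha A p)) ^t* *m (sepform gamma C p) ^t*.

(* As invmx M = M for a singular M, the invertibility that the inverse in the
   essential supremum presupposes (off a null set) is stated separately.
   Extending the nonnegative function by 0 outside P makes the essential
   supremum the one over P, except that it is 0 and not -oo if mu P = 0. *)
Definition Sigma_St : Prop :=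
  {ae mu, forall p, P p -> sepform alpha A p \in unitmx} /\
  forall i : 'I_qA,
    (ess_sup mu
      ((fun p => (frobnorm (alpha i p *: invmx (sepform alpha A p)))%:E) \_ P)
     < +oo)%E.

(* Real-valued: Rintegral is 0 where the integral is infinite, which does not
   happen on the open set Sigma_St under the theorem's integrability
   assumptions. *)
Definition objective : R :=
  \int[mu]_(p in P) (frobnorm (H p - output p) ^+ 2).

End strom.

(* Main.v *)
Require Import Defs.
From HB Require Import structures.
From mathcomp Require Import all_boot all_order all_algebra.
From mathcomp Require Import complex.
From mathcomp Require Import all_classical all_reals all_analysis.
From mathcomp Require Import ess_sup_inf.
From mathcomp Require Import measurable_realfun ring lra.

Set Implicit Arguments.
Unset Strict Implicit.
Unset Printing Implicit Defensive.

Import Order.TTheory GRing.Theory Num.Def Num.Theory.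
Import numFieldNormedType.Exports.
Import Normc.

Local Open Scope classical_set_scope.
Local Open Scope ring_scope.
Local Open Scope sesquilinear_scope.

(** The objective is a mean square of the residual H - output, and each of the
    three partial maps of the residual has, at almost every p, an expansion
      F(X + D) = F(X) + a U D V + remainder
    in which a is a scalar and U, V are matrices depending on p. Expanding the
    squared Frobenius norm gives
      |F(X + D)|^2 = |F(X)|^2 + 2 Re <a U D V, F(X)> + O(|D|^2),
    and the adjoint of D |-> a U D V turns the middle term into
    2 Re <G, D> with G = conj(a) U^* F(X) V^*. For a real-valued function the
    gradient with respect to the conjugate variable is the G of such an
    expansion, so what has to be shown is that it may be integrated.

    The remainders are dominated through the weight
    w = sum |beta_j| sum |gamma_k| / sum |alpha_i|, whose square is integrable.
    On Sigma_St the sum over i of |alpha_i| |A(p)^-1| is essentially bounded, by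
    K say, so |A(p)^-1| <= K / sum |alpha_i| and the product of the norms of
    C(p), A(p)^-1 and B(p) is at most a constant times w (Sigma_St_bounds). In
    particular the output is square-integrable, and then so is the residual. If
    |a| |U| |V| is at most a constant times w and the remainder at most a
    constant times w |D|^2, the error of the second-order expansion is at most
    a constant times (w^2 + |F(X)|^2) |D|^2, which is integrable
    (is_conj_gradient_mean_square).

    In the coefficients of B and C the residual is affine and the remainder
    vanishes. In those of A one has, with M = A(p), E = alpha_i(p) D and
    J = (M + E)^-1,
      J = M^-1 - M^-1 E M^-1 + M^-1 E J E M^-1.
    The bound K makes |M^-1| |E| <= K |D| small uniformly in p, so M + E is
    invertible with |J| <= 2 |M^-1| for almost every p as soon as D is small,
    and the last term is of second order with the weight w. *)

(** * Entrywise norms of complex matrices *)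

Lemma normc_ge0 (R : realType) (z : R[i]) : 0 <= normc z.
Proof. by case: z => a b; exact: sqrtr_ge0. Qed.

Lemma normc_conj (R : realType) (z : R[i]) : normc z^* = normc z.
Proof. by case: z => a b; rewrite /= sqrrN. Qed.

Lemma sqr_normcE (R : realType) (z : R[i]) :
  normc z ^+ 2 = complex.Re z ^+ 2 + complex.Im z ^+ 2.
Proof. by case: z => a b; rewrite /= sqr_sqrtr// addr_ge0 ?sqr_ge0. Qed.

Lemma normc_real (R : realType) (x : R) : normc x%:C%C = `|x|.
Proof. by rewrite /= expr0n addr0 sqrtr_sqr. Qed.

Lemma le_normc_sum (R : realType) (I : Type) (s : seq I) (Q : pred I)
    (f : I -> R[i]) :
  normc (\sum_(i <- s | Q i) f i) <= \sum_(i <- s | Q i) normc (f i).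
Proof.
elim/big_ind2 : _ => [|x1 x2 y1 y2 h1 h2|//]; first by rewrite normc0.
by rewrite (le_trans (le_normcD _ _))// lerD.
Qed.

Lemma normr_Re (R : realType) (z : R[i]) : `|complex.Re z| <= normc z.
Proof.
rewrite -(@ler_pXn2r _ 2)// ?nnegrE ?normc_ge0//.
by rewrite sqr_normcE real_normK ?num_real// lerDl sqr_ge0.
Qed.

Lemma normr_Im (R : realType) (z : R[i]) : `|complex.Im z| <= normc z.
Proof.
rewrite -(@ler_pXn2r _ 2)// ?nnegrE ?normc_ge0//.
by rewrite sqr_normcE real_normK ?num_real// lerDr sqr_ge0.
Qed.

Lemma Re_sum (R : realType) (I : Type) (s : seq I) (Q : pred I)
    (f : I -> R[i]) :
  complex.Re (\sum_(i <- s | Q i) f i) = \sum_(i <- s | Q i) complex.Re (f i).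
Proof. by apply: (big_morph (@complex.Re R)) => // -[? ?] []. Qed.

Lemma conjc_sum (R : realType) (I : Type) (s : seq I) (Q : pred I)
    (f : I -> R[i]) :
  (\sum_(i <- s | Q i) f i)^* = \sum_(i <- s | Q i) (f i)^*.
Proof. exact: rmorph_sum. Qed.

(** Its triangle inequality and submultiplicativity are those of the modulus, and
    in a fixed dimension it is equivalent to the Frobenius norm, which is all
    that bounds with unspecified constants require. *)
Definition entrynorm (R : realType) m n (M : 'M[R[i]]_(m, n)) : R :=
  \sum_(i < m) \sum_(j < n) normc (M i j).

Section entrynorm.
Context {R : realType}.

Lemma entrynorm_ge0 m n (M : 'M[R[i]]_(m, n)) : 0 <= entrynorm M.
Proof. by apply: sumr_ge0 => i _; apply: sumr_ge0 => j _; exact: normc_ge0. Qed.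

Lemma le_entrynorm_entry m n (M : 'M[R[i]]_(m, n)) i j :
  normc (M i j) <= entrynorm M.
Proof.
rewrite /entrynorm (bigD1 i)//= (bigD1 j)//= -addrA lerDl addr_ge0//.
  by apply: sumr_ge0 => l _; exact: normc_ge0.
by apply: sumr_ge0 => k _; apply: sumr_ge0 => l _; exact: normc_ge0.
Qed.

Lemma entrynorm_eq0 m n (M : 'M[R[i]]_(m, n)) : entrynorm M <= 0 -> M = 0.
Proof.
move=> M0; apply/matrixP => i j; rewrite mxE; apply: eq0_normc.
by apply/eqP; rewrite eq_le normc_ge0 andbT (le_trans (le_entrynorm_entry _ _ _)).
Qed.

Lemma entrynormD m n (M N : 'M[R[i]]_(m, n)) :
  entrynorm (M + N) <= entrynorm M + entrynorm N.
Proof.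
rewrite /entrynorm -big_split/=; apply: ler_sum => i _.
rewrite -big_split/=; apply: ler_sum => j _.
by rewrite mxE; exact: le_normcD.
Qed.

Lemma entrynormZ m n a (M : 'M[R[i]]_(m, n)) :
  entrynorm (a *: M) = normc a * entrynorm M.
Proof.
rewrite /entrynorm mulr_sumr; apply: eq_bigr => i _.
by rewrite mulr_sumr; apply: eq_bigr => j _; rewrite mxE normcM.
Qed.

Lemma entrynormN m n (M : 'M[R[i]]_(m, n)) : entrynorm (- M) = entrynorm M.
Proof.
by apply: eq_bigr => i _; apply: eq_bigr => j _; rewrite mxE; exact: normcN.
Qed.

Lemma entrynormB m n (M N : 'M[R[i]]_(m, n)) :
  entrynorm (M - N) <= entrynorm M + entrynorm N.
Proof. by rewrite (le_trans (entrynormD _ _))// entrynormN. Qed.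

Lemma entrynorm0 m n : entrynorm (0 : 'M[R[i]]_(m, n)) = 0.
Proof. by rewrite -(scale0r 0) entrynormZ normc0 mul0r. Qed.

Lemma entrynorm_sum m n (I : Type) (s : seq I) (f : I -> 'M[R[i]]_(m, n)) :
  entrynorm (\sum_(i <- s) f i) <= \sum_(i <- s) entrynorm (f i).
Proof.
elim/big_ind2 : _ => [|x1 x2 y1 y2 h1 h2|//]; first by rewrite entrynorm0.
by rewrite (le_trans (entrynormD _ _))// lerD.
Qed.

Lemma entrynormM m n p (M : 'M[R[i]]_(m, n)) (N : 'M[R[i]]_(n, p)) :
  entrynorm (M *m N) <= entrynorm M * entrynorm N.
Proof.
rewrite {1 2}/entrynorm mulr_suml; apply: ler_sum => i _.
apply: (@le_trans _ _ (\sum_j \sum_k normc (M i k) * normc (N k j))).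
  apply: ler_sum => j _; rewrite mxE (le_trans (le_normc_sum _ _ _))//.
  by apply: ler_sum => k _; rewrite normcM.
rewrite exchange_big/= mulr_suml; apply: ler_sum => k _.
rewrite -mulr_sumr ler_wpM2l ?normc_ge0//.
rewrite /entrynorm (bigD1 k)//= lerDl.
by apply: sumr_ge0 => l _; apply: sumr_ge0 => j _; exact: normc_ge0.
Qed.

Lemma entrynormM_le m n p (M : 'M[R[i]]_(m, n)) (N : 'M[R[i]]_(n, p)) x y :
  entrynorm M <= x -> entrynorm N <= y -> entrynorm (M *m N) <= x * y.
Proof.
move=> Mx Ny; rewrite (le_trans (entrynormM _ _))//.
by rewrite ler_pM ?entrynorm_ge0.
Qed.

Lemma entrynorm_adj m n (M : 'M[R[i]]_(m, n)) : entrynorm (M ^t*) = entrynorm M.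
Proof.
rewrite /entrynorm exchange_big/=; apply: eq_bigr => i _; apply: eq_bigr => j _.
by rewrite !mxE normc_conj.
Qed.

Lemma sqr_frobnorm m n (M : 'M[R[i]]_(m, n)) :
  frobnorm M ^+ 2 = \sum_(i < m) \sum_(j < n) normc (M i j) ^+ 2.
Proof.
rewrite sqr_sqrtr//; apply: sumr_ge0 => i _; apply: sumr_ge0 => j _.
exact: sqr_ge0.
Qed.

Lemma frobnorm_ge0 m n (M : 'M[R[i]]_(m, n)) : 0 <= frobnorm M.
Proof. exact: sqrtr_ge0. Qed.

Lemma frobnorm_le_entrynorm m n (M : 'M[R[i]]_(m, n)) :
  frobnorm M <= entrynorm M.
Proof.
rewrite -(@ler_pXn2r _ 2)// ?nnegrE ?frobnorm_ge0 ?entrynorm_ge0//.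
rewrite sqr_frobnorm expr2 {1}/entrynorm mulr_suml; apply: ler_sum => i _.
rewrite mulr_suml; apply: ler_sum => j _.
by rewrite expr2 ler_wpM2l ?normc_ge0// le_entrynorm_entry.
Qed.

Lemma entrynorm_le_frobnorm m n (M : 'M[R[i]]_(m, n)) :
  entrynorm M <= (m * n)%:R * frobnorm M.
Proof.
have le_entry i j : normc (M i j) <= frobnorm M.
  rewrite -(@ler_pXn2r _ 2)// ?nnegrE ?frobnorm_ge0 ?normc_ge0//.
  rewrite sqr_frobnorm (bigD1 i)//= (bigD1 j)//= -addrA lerDl addr_ge0//.
    by apply: sumr_ge0 => l _; exact: sqr_ge0.
  by apply: sumr_ge0 => k _; apply: sumr_ge0 => l _; exact: sqr_ge0.
apply: (@le_trans _ _ (\sum_(i < m) \sum_(j < n) frobnorm M)).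
  by apply: ler_sum => i _; apply: ler_sum => j _.
by rewrite !sumr_const !card_ord -mulrnA mulr_natl mulnC.
Qed.

End entrynorm.

(** * The real part of the Frobenius inner product *)

Section frobdot.
Context {R : realType}.

Lemma Re_mul_conj (y z : R[i]) : complex.Re (y * z^*) =
  complex.Re y * complex.Re z + complex.Im y * complex.Im z.
Proof. by case: y => a b; case: z => c d /=; rewrite mulrN opprK. Qed.

Lemma Re_frobdot m n (Y Z : 'M[R[i]]_(m, n)) : complex.Re (frobdot Y Z) =
  \sum_(i < m) \sum_(j < n) (complex.Re (Y i j) * complex.Re (Z i j) +
                             complex.Im (Y i j) * complex.Im (Z i j)).
Proof.
rewrite Re_sum; apply: eq_bigr => i _; rewrite Re_sum; apply: eq_bigr => j _.
exact: Re_mul_conj.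
Qed.

Lemma Re_frobdotC m n (Y Z : 'M[R[i]]_(m, n)) :
  complex.Re (frobdot Y Z) = complex.Re (frobdot Z Y).
Proof.
rewrite !Re_frobdot; apply: eq_bigr => i _; apply: eq_bigr => j _.
by rewrite mulrC [X in _ + X]mulrC.
Qed.

Lemma frobdotDl m n (Y Y' Z : 'M[R[i]]_(m, n)) :
  frobdot (Y + Y') Z = frobdot Y Z + frobdot Y' Z.
Proof.
rewrite /frobdot -big_split; apply: eq_bigr => i _ /=.
by rewrite -big_split; apply: eq_bigr => j _ /=; rewrite mxE mulrDl.
Qed.

Lemma frobdot_trace m n (Y Z : 'M[R[i]]_(m, n)) :
  frobdot Y Z = \tr (Y *m Z ^t*).
Proof.
apply: eq_bigr => i _; rewrite mxE; apply: eq_bigr => j _.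
by rewrite !mxE.
Qed.

Lemma le_normc_frobdot m n (Y Z : 'M[R[i]]_(m, n)) :
  normc (frobdot Y Z) <= entrynorm Y * entrynorm Z.
Proof.
rewrite (le_trans (le_normc_sum _ _ _))// {1}/entrynorm mulr_suml.
apply: ler_sum => i _; rewrite (le_trans (le_normc_sum _ _ _))// mulr_suml.
apply: ler_sum => j _; rewrite normcM normc_conj ler_wpM2l ?normc_ge0//.
exact: le_entrynorm_entry.
Qed.

Lemma adj_mulmx m n p (M : 'M[R[i]]_(m, n)) (N : 'M[R[i]]_(n, p)) :
  (M *m N) ^t* = N ^t* *m M ^t*.
Proof. by rewrite trmx_mul map_mxM. Qed.

Lemma adj_scale m n (a : R[i]) (M : 'M[R[i]]_(m, n)) :
  (a *: M) ^t* = a^* *: M ^t*.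
Proof. by apply/matrixP => i j; rewrite !mxE rmorphM. Qed.

(** The adjoint of the map that sends D to a U D V. *)
Lemma frobdot_adj m n p q (a : R[i]) (U : 'M[R[i]]_(m, n)) (D : 'M[R[i]]_(n, p))
    (V : 'M[R[i]]_(p, q)) (E : 'M[R[i]]_(m, q)) :
  frobdot (a *: (U *m D *m V)) E = frobdot D (a^* *: (U ^t* *m E *m V ^t*)).
Proof.
rewrite !frobdot_trace adj_scale !adj_mulmx !trmxCK conjCK.
rewrite -scalemxAl -scalemxAr !mxtraceZ; congr (_ * _).
by rewrite -!mulmxA mxtrace_mulC !mulmxA.
Qed.

Lemma sqr_frobnormD m n (E Y : 'M[R[i]]_(m, n)) :
  frobnorm (E + Y) ^+ 2 =
  frobnorm E ^+ 2 + 2 * complex.Re (frobdot Y E) + frobnorm Y ^+ 2.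
Proof.
rewrite Re_frobdot !sqr_frobnorm mulr_sumr -!big_split; apply: eq_bigr => i _.
rewrite mulr_sumr -!big_split; apply: eq_bigr => j _ /=.
by rewrite mxE !sqr_normcE; case: (E i j) => a b; case: (Y i j) => c d /=; ring.
Qed.

(** First-order expansion of the squared norm when the perturbation Y is only
    known up to a linear approximation L. *)
Lemma sqr_frobnorm_expansion m n (E Y L : 'M[R[i]]_(m, n)) :
  `|frobnorm (E + Y) ^+ 2 - frobnorm E ^+ 2 - 2 * complex.Re (frobdot L E)|
  <= 2 * (entrynorm (Y - L) * entrynorm E) + entrynorm Y ^+ 2.
Proof.
have -> : frobnorm (E + Y) ^+ 2 - frobnorm E ^+ 2
    - 2 * complex.Re (frobdot L E)
  = 2 * complex.Re (frobdot (Y - L) E) + frobnorm Y ^+ 2.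
  have : frobdot Y E = frobdot (Y - L) E + frobdot L E.
    by rewrite -frobdotDl subrK.
  rewrite sqr_frobnormD => ->; case: (frobdot _ _) => a b.
  by case: (frobdot _ _) => c e /=; ring.
rewrite (le_trans (ler_normD _ _))// lerD//.
  rewrite normrM ger0_norm// ler_wpM2l// (le_trans (normr_Re _))//.
  exact: le_normc_frobdot.
rewrite ger0_norm ?sqr_ge0// ler_pXn2r ?nnegrE ?frobnorm_ge0 ?entrynorm_ge0//.
exact: frobnorm_le_entrynorm.
Qed.

End frobdot.

(** * Measurability of complex matrix operations *)

Section cmeasurable.
Context {R : realType} {d : measure_display} {T : measurableType d}.
Variable D : set T.
Implicit Types f g : T -> R[i].

Lemma cmeasurable_cst (c : R[i]) : cmeasurable_fun D (fun=> c).
Proof. by split; exact: measurable_cst. Qed.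

Lemma cmeasurable_conj f :
  cmeasurable_fun D f -> cmeasurable_fun D (fun x => (f x)^*).
Proof.
move=> [mr mi]; split.
  by apply: eq_measurable_fun mr => x _; case: (f x).
by apply: eq_measurable_fun (measurable_funN mi) => x _ /=; case: (f x).
Qed.

Lemma cmeasurableD f g : cmeasurable_fun D f -> cmeasurable_fun D g ->
  cmeasurable_fun D (fun x => f x + g x).
Proof.
move=> [fr fi] [gr gi]; split.
  apply: eq_measurable_fun (measurable_funD fr gr) => x _ /=.
  by case: (f x); case: (g x).
apply: eq_measurable_fun (measurable_funD fi gi) => x _ /=.
by case: (f x); case: (g x).
Qed.

Lemma cmeasurableM f g : cmeasurable_fun D f -> cmeasurable_fun D g ->
  cmeasurable_fun D (fun x => f x * g x).
Proof.
move=> [fr fi] [gr gi]; split.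
  apply: (eq_measurable_fun (fun x => complex.Re (f x) * complex.Re (g x)
      - complex.Im (f x) * complex.Im (g x))) => [x _ /=|].
    by case: (f x) => ? ?; case: (g x).
  by apply: measurable_funB; exact: measurable_funM.
apply: (eq_measurable_fun (fun x => complex.Re (f x) * complex.Im (g x)
    + complex.Im (f x) * complex.Re (g x))) => [x _ /=|].
  by case: (f x) => ? ?; case: (g x).
by apply: measurable_funD; exact: measurable_funM.
Qed.

Lemma cmeasurableN f : cmeasurable_fun D f -> cmeasurable_fun D (fun x => - f x).
Proof.
move=> mf; under eq_fun do rewrite -mulN1r.
by apply: cmeasurableM => //; exact: cmeasurable_cst.
Qed.

Lemma cmeasurable_sum (I : Type) (s : seq I) (F : I -> T -> R[i]) :
  (forall i, cmeasurable_fun D (F i)) ->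
  cmeasurable_fun D (fun x => \sum_(i <- s) F i x).
Proof.
move=> mF; elim: s => [|i s IH].
  by under eq_fun do rewrite big_nil; exact: cmeasurable_cst.
by under eq_fun do rewrite big_cons; apply: cmeasurableD.
Qed.

Lemma cmeasurable_prod (I : Type) (s : seq I) (F : I -> T -> R[i]) :
  (forall i, cmeasurable_fun D (F i)) ->
  cmeasurable_fun D (fun x => \prod_(i <- s) F i x).
Proof.
move=> mF; elim: s => [|i s IH].
  by under eq_fun do rewrite big_nil; exact: cmeasurable_cst.
by under eq_fun do rewrite big_cons; apply: cmeasurableM.
Qed.

Lemma measurable_ge0_inv (f : T -> R) : (forall x, 0 <= f x) ->
  measurable_fun D f -> measurable_fun D (fun x => (f x)^-1).
Proof.
move=> f0 mf; under eq_fun do rewrite -powR_inv1//.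
exact: (measurableT_comp (measurable_powR _)).
Qed.

Lemma measurable_normc f :
  cmeasurable_fun D f -> measurable_fun D (fun x => normc (f x)).
Proof.
move=> [mr mi]; apply: (eq_measurable_fun (fun x =>
    (complex.Re (f x) ^+ 2 + complex.Im (f x) ^+ 2) `^ (2^-1))) => [x _|].
  by rewrite powR12_sqrt ?addr_ge0 ?sqr_ge0//; case: (f x).
apply: (measurableT_comp (measurable_powR _)).
by apply: measurable_funD; exact: measurable_funX.
Qed.

(** As 1/z is conj(z) / |z|^2, only the inverse of a nonnegative real function
    has to be measurable. *)
Lemma cmeasurableV f :
  cmeasurable_fun D f -> cmeasurable_fun D (fun x => (f x)^-1).
Proof.
move=> [mr mi]; have mV : measurable_fun D
    (fun x => (complex.Re (f x) ^+ 2 + complex.Im (f x) ^+ 2)^-1).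
  apply: measurable_ge0_inv => [x|]; first by rewrite addr_ge0 ?sqr_ge0.
  by apply: measurable_funD; exact: measurable_funX.
split.
  apply: eq_measurable_fun (measurable_funM mr mV) => x _ /=.
  by case: (f x).
apply: eq_measurable_fun (measurable_funN (measurable_funM mi mV)) => x _ /=.
by case: (f x).
Qed.

Definition mxmeasurable m n (F : T -> 'M[R[i]]_(m, n)) : Prop :=
  forall i j, cmeasurable_fun D (fun x => F x i j).

Lemma mxmeasurable_cst m n (M : 'M[R[i]]_(m, n)) : mxmeasurable (fun=> M).
Proof. by move=> i j; exact: cmeasurable_cst. Qed.

Lemma mxmeasurableD m n (F G : T -> 'M[R[i]]_(m, n)) :
  mxmeasurable F -> mxmeasurable G -> mxmeasurable (fun x => F x + G x).
Proof.
by move=> mF mG i j; under eq_fun do rewrite mxE; exact: cmeasurableD.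
Qed.

Lemma mxmeasurableZ m n (a : T -> R[i]) (F : T -> 'M[R[i]]_(m, n)) :
  cmeasurable_fun D a -> mxmeasurable F -> mxmeasurable (fun x => a x *: F x).
Proof.
by move=> ma mF i j; under eq_fun do rewrite mxE; exact: cmeasurableM.
Qed.

Lemma mxmeasurableN m n (F : T -> 'M[R[i]]_(m, n)) :
  mxmeasurable F -> mxmeasurable (fun x => - F x).
Proof.
by move=> mF i j; under eq_fun do rewrite mxE; exact: cmeasurableN.
Qed.

Lemma mxmeasurableB m n (F G : T -> 'M[R[i]]_(m, n)) :
  mxmeasurable F -> mxmeasurable G -> mxmeasurable (fun x => F x - G x).
Proof. by move=> mF mG; apply: mxmeasurableD => //; exact: mxmeasurableN. Qed.

Lemma mxmeasurableM m n p (F : T -> 'M[R[i]]_(m, n)) (G : T -> 'M[R[i]]_(n, p)) :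
  mxmeasurable F -> mxmeasurable G -> mxmeasurable (fun x => F x *m G x).
Proof.
move=> mF mG i j; under eq_fun do rewrite mxE.
by apply: cmeasurable_sum => k; exact: cmeasurableM.
Qed.

Lemma mxmeasurable_adj m n (F : T -> 'M[R[i]]_(m, n)) :
  mxmeasurable F -> mxmeasurable (fun x => (F x) ^t*).
Proof.
by move=> mF i j; under eq_fun do rewrite !mxE; exact: cmeasurable_conj.
Qed.

Lemma mxmeasurable_sum m n (I : Type) (s : seq I)
    (F : I -> T -> 'M[R[i]]_(m, n)) : (forall i, mxmeasurable (F i)) ->
  mxmeasurable (fun x => \sum_(i <- s) F i x).
Proof.
move=> mF i j; under eq_fun do rewrite summxE.
by apply: cmeasurable_sum => k; exact: mF.
Qed.

Lemma cmeasurable_det n (F : T -> 'M[R[i]]_n) :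
  mxmeasurable F -> cmeasurable_fun D (fun x => \det (F x)).
Proof.
move=> mF; apply: cmeasurable_sum => s.
by apply: cmeasurableM; [exact: cmeasurable_cst|exact: cmeasurable_prod].
Qed.

Lemma mxmeasurable_adjugate n (F : T -> 'M[R[i]]_n) :
  mxmeasurable F -> mxmeasurable (fun x => \adj (F x)).
Proof.
move=> mF i j; under eq_fun do rewrite mxE.
apply: cmeasurableM; first exact: cmeasurable_cst.
by apply: cmeasurable_det => k l; under eq_fun do rewrite !mxE; exact: mF.
Qed.

(** A formula for the inverse without case distinction: since 1 / 0 = 0, the
    factor 1 - det M / det M is 0 for an invertible M and 1 for a singular one,
    for which invmx M = M. It makes the inverse measurable by composition. *)
Lemma invmxE n (M : 'M[R[i]]_n) :
  invmx M = (\det M)^-1 *: \adj M + (1 - \det M / \det M) *: M.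
Proof.
rewrite /invmx unitmxE unitfE; have [->|M0] := eqVneq (\det M) 0.
  by rewrite invr0 scale0r mul0r subr0 scale1r add0r.
by rewrite divff// subrr scale0r addr0.
Qed.

Lemma mxmeasurable_inv n (F : T -> 'M[R[i]]_n) :
  mxmeasurable F -> mxmeasurable (fun x => invmx (F x)).
Proof.
move=> mF; under eq_fun do rewrite invmxE; have mdet := cmeasurable_det mF.
apply: mxmeasurableD; apply: mxmeasurableZ => //.
- exact: cmeasurableV.
- exact: mxmeasurable_adjugate.
- apply: cmeasurableD; first exact: cmeasurable_cst.
  by apply/cmeasurableN/cmeasurableM => //; exact: cmeasurableV.
Qed.

Lemma measurable_sqr_frobnorm m n (F : T -> 'M[R[i]]_(m, n)) :
  mxmeasurable F -> measurable_fun D (fun x => frobnorm (F x) ^+ 2).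
Proof.
move=> mF; under eq_fun do rewrite sqr_frobnorm.
apply: measurable_sum => i; apply: measurable_sum => j.
by apply: measurable_funX; exact: measurable_normc.
Qed.

End cmeasurable.

(** * Differentiation of a mean-square functional *)

Section domination.
Context {R : realType} {d : measure_display} {T : measurableType d}.
Variables (mu : {measure set T -> \bar R}) (D : set T).
Hypothesis mD : measurable D.
Implicit Types f g : T -> R.

Lemma ae_le_integrable f g : measurable_fun D f ->
  mu.-integrable D (EFin \o g) ->
  {ae mu, forall x, D x -> `|f x| <= g x} ->
  mu.-integrable D (EFin \o f).
Proof.
move=> mf /integrableP[mg ig] fg; apply/integrableP; split.
  exact/measurable_EFinP.
apply: (le_lt_trans _ ig); apply: ae_ge0_le_integral => //.
- by apply: measurableT_comp => //; exact/measurable_EFinP.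
- exact: measurableT_comp.
- apply: filterS fg => x fg Dx; rewrite lee_fin.
  by rewrite (le_trans (fg Dx))// ler_norm.
Qed.

Lemma ae_le_normr_Rintegral f g : measurable_fun D f ->
  mu.-integrable D (EFin \o g) ->
  {ae mu, forall x, D x -> `|f x| <= g x} ->
  `|\int[mu]_(x in D) f x| <= \int[mu]_(x in D) `|g x|.
Proof.
move=> mf ig fg; have intf := ae_le_integrable mf ig fg.
have intnf := integrable_norm intf; have intng := integrable_norm ig.
apply: (le_trans (le_normr_Rintegral mD intf)); apply: fine_le.
- exact: (integrable_fin_num mD intnf).
- exact: (integrable_fin_num mD intng).
apply: ae_ge0_le_integral => //.
- exact: measurable_int intnf.
- exact: measurable_int intng.
- apply: filterS fg => x fg Dx; rewrite lee_fin.
  by rewrite (le_trans (fg Dx))// ler_norm.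
Qed.

Lemma integrable_sumr (I : Type) (s : seq I) (f : I -> T -> R) :
  (forall i, mu.-integrable D (EFin \o f i)) ->
  mu.-integrable D (EFin \o (fun x => \sum_(i <- s) f i x)).
Proof.
move=> intf; apply: (eq_integrable mD _ _ _ (integrable_sum mD s (fun i _ => intf i))).
by move=> x _; rewrite /= sumEFin.
Qed.

Lemma Rintegral_sum (I : Type) (s : seq I) (f : I -> T -> R) :
  (forall i, mu.-integrable D (EFin \o f i)) ->
  \int[mu]_(x in D) (\sum_(i <- s) f i x) =
  \sum_(i <- s) \int[mu]_(x in D) f i x.
Proof.
move=> intf; elim: s => [|i s IH].
  under eq_Rintegral do rewrite big_nil.
  by rewrite Rintegral_cst// big_nil mul0r.
under eq_Rintegral do rewrite big_cons.
by rewrite RintegralD ?big_cons ?IH//; exact: integrable_sumr.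
Qed.

Lemma integrable_linear f g (a b : R) :
  mu.-integrable D (EFin \o f) -> mu.-integrable D (EFin \o g) ->
  mu.-integrable D (EFin \o (fun x => a * f x + b * g x)).
Proof.
move=> intf intg.
apply: (eq_integrable mD _ _ _
  (integrableD mD (integrableZl mD a intf) (integrableZl mD b intg))).
by move=> x _.
Qed.

Definition cintegrable (f : T -> R[i]) : Prop :=
  mu.-integrable D (EFin \o (fun x => complex.Re (f x))) /\
  mu.-integrable D (EFin \o (fun x => complex.Im (f x))).

Lemma ae_le_cintegrable (f : T -> R[i]) g : cmeasurable_fun D f ->
  mu.-integrable D (EFin \o g) ->
  {ae mu, forall x, D x -> normc (f x) <= g x} -> cintegrable f.
Proof.
move=> [mr mi] ig fg; split; apply: ae_le_integrable ig _ => //.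
  by apply: filterS fg => x fg Dx; exact: le_trans (normr_Re _) (fg Dx).
by apply: filterS fg => x fg Dx; exact: le_trans (normr_Im _) (fg Dx).
Qed.

Lemma integrable_Re_frobdot m n (G : T -> 'M[R[i]]_(m, n)) (Z : 'M[R[i]]_(m, n)) :
  (forall i j, cintegrable (fun x => G x i j)) ->
  mu.-integrable D (EFin \o (fun x => complex.Re (frobdot (G x) Z))).
Proof.
move=> intG; under eq_fun do rewrite Re_frobdot.
apply: integrable_sumr => i; apply: integrable_sumr => j.
have [intr inti] := intG i j.
apply: (eq_integrable mD _ _ _ (integrable_linear (complex.Re (Z i j))
  (complex.Im (Z i j)) intr inti)).
by move=> x _ /=; rewrite mulrC [X in (_ + X)%:E]mulrC.
Qed.

Lemma Re_frobdot_mxintegral m n (G : T -> 'M[R[i]]_(m, n))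
    (Z : 'M[R[i]]_(m, n)) : (forall i j, cintegrable (fun x => G x i j)) ->
  complex.Re (frobdot (mxintegral mu D G) Z) =
  \int[mu]_(x in D) complex.Re (frobdot (G x) Z).
Proof.
move=> intG; rewrite Re_frobdot; under eq_Rintegral do rewrite Re_frobdot.
have intGZ i j : mu.-integrable D (EFin \o (fun x =>
    complex.Re (G x i j) * complex.Re (Z i j) +
    complex.Im (G x i j) * complex.Im (Z i j))).
  have [intr inti] := intG i j.
  apply: (eq_integrable mD _ _ _ (integrable_linear (complex.Re (Z i j))
    (complex.Im (Z i j)) intr inti)).
  by move=> x _ /=; rewrite mulrC [X in (_ + X)%:E]mulrC.
rewrite Rintegral_sum => [|i]; last exact: integrable_sumr.
apply: eq_bigr => i _; rewrite Rintegral_sum//; apply: eq_bigr => j _.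
have [intr inti] := intG i j.
rewrite mxE /= RintegralD ?RintegralZr//.
- by apply: (eq_integrable mD _ _ _ (integrableZr mD (complex.Re (Z i j)) intr)) => x _.
- by apply: (eq_integrable mD _ _ _ (integrableZr mD (complex.Im (Z i j)) inti)) => x _.
Qed.

(** For a real-valued function the two Wirtinger gradients are conjugate to each
    other, so that the first-order term is twice a real part. *)
Lemma is_conj_gradient_Re m n (f : 'M[R[i]]_(m, n) -> R) (X G : 'M[R[i]]_(m, n))
    (K d0 : R) : 0 < d0 -> 0 <= K ->
  (forall Z, entrynorm Z < d0 ->
    `|f (X + Z) - f X - 2 * complex.Re (frobdot G Z)| <= K * entrynorm Z ^+ 2) ->
  is_conj_gradient f X G.
Proof.
move=> d0_gt0 K0 expansion; exists (map_mx conjC G) => e e0.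
pose c : R := (m * n)%:R; have c0 : 0 <= c by exact: ler0n.
have c1 : 0 < c + 1 by rewrite ltr_wpDl.
have K1 : 0 < K * c ^+ 2 + 1 by rewrite ltr_wpDl// mulr_ge0// sqr_ge0.
exists (minr (d0 / (c + 1)) (e / (K * c ^+ 2 + 1))).
  by rewrite lt_min !divr_gt0.
move=> Z; rewrite lt_min !ltr_pdivlMr// => /andP[Zd0 Ze].
have F0 := frobnorm_ge0 Z; have ZF := entrynorm_le_frobnorm Z.
have -> : (f (X + Z))%:C%C - ((f X)%:C%C + frobdot (map_mx conjC G)
      (map_mx conjC Z) + frobdot G Z)
    = (f (X + Z) - f X - 2 * complex.Re (frobdot G Z))%:C%C.
  have -> : frobdot (map_mx conjC G) (map_mx conjC Z) = (frobdot G Z)^*.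
    rewrite conjc_sum; apply: eq_bigr => i _.
    by rewrite conjc_sum; apply: eq_bigr => j _; rewrite !mxE rmorphM.
  case: (frobdot G Z) => a b; apply/eqP; rewrite eq_complex /=.
  by apply/andP; split; apply/eqP; ring.
rewrite normc_real (le_trans (expansion _ _))//.
  by rewrite (le_lt_trans ZF)// (le_lt_trans _ Zd0)// mulrC ler_wpM2l ?lerDl.
apply: (@le_trans _ _ (K * (c * frobnorm Z) ^+ 2)).
  rewrite ler_wpM2l// ler_pXn2r// nnegrE ?entrynorm_ge0//.
  by rewrite mulr_ge0.
rewrite exprMn mulrA expr2 mulrA ler_wpM2r//.
apply: le_trans (ltW Ze); rewrite mulrC; apply: ler_wpM2l => //.
by rewrite lerDl.
Qed.

End domination.

Section mean_square.
Context {R : realType} {d : measure_display} {T : measurableType d}.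
Variables (mu : {measure set T -> \bar R}) (D : set T).
Hypothesis mD : measurable D.

(** The squared norm of F (X + Z) differs from its first-order expansion by at
    most |Z|^2 times a fixed integrable function: with E = F X, the cross term
    of E and the remainder is bounded by 2 k w |E| <= k (w^2 + |E|^2), and the
    square of the increment by k^2 (1 + d0)^2 w^2. The form a U Z V of the
    linear part is the one for which the adjoint is explicit. *)
Lemma is_conj_gradient_mean_square m n p q
    (F : 'M[R[i]]_(m, n) -> T -> 'M[R[i]]_(p, q)) (X : 'M[R[i]]_(m, n))
    (a : T -> R[i]) (U : T -> 'M[R[i]]_(p, m)) (V : T -> 'M[R[i]]_(n, q))
    (w : T -> R) (k d0 : R) :
  0 <= k -> 0 < d0 ->
  (forall Z, mxmeasurable D (F Z)) ->
  cmeasurable_fun D a -> mxmeasurable D U -> mxmeasurable D V ->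
  (forall x, 0 <= w x) ->
  mu.-integrable D (EFin \o (fun x => w x ^+ 2)) ->
  mu.-integrable D (EFin \o (fun x => frobnorm (F X x) ^+ 2)) ->
  {ae mu, forall x, D x ->
    normc (a x) * entrynorm (U x) * entrynorm (V x) <= k * w x} ->
  (forall Z, entrynorm Z < d0 -> {ae mu, forall x, D x ->
    entrynorm (F (X + Z) x - F X x - a x *: (U x *m Z *m V x))
    <= k * w x * entrynorm Z ^+ 2}) ->
  is_conj_gradient (fun Z => \int[mu]_(x in D) (frobnorm (F Z x) ^+ 2)) X
    (mxintegral mu D (fun x => (a x)^* *: ((U x) ^t* *m F X x *m (V x) ^t*))).
Proof.
move=> k0 d0_gt0 mF ma mU mV w0 intw intF abound remainder.
pose G x := (a x)^* *: ((U x) ^t* *m F X x *m (V x) ^t*).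
pose c : R := (p * q)%:R.
pose h x := k * w x ^+ 2 + k * c ^+ 2 * frobnorm (F X x) ^+ 2.
have inth : mu.-integrable D (EFin \o h) by exact: integrable_linear.
have h_bound x : 2 * (k * w x * entrynorm (F X x)) <= h x.
  (* The square of w - |F X| is nonnegative. *)
  have wF : 2 * (w x * entrynorm (F X x)) <= w x ^+ 2 + entrynorm (F X x) ^+ 2.
    rewrite -subr_ge0; have := sqr_ge0 (w x - entrynorm (F X x)).
    by congr (0 <= _); ring.
  have FF : entrynorm (F X x) ^+ 2 <= c ^+ 2 * frobnorm (F X x) ^+ 2.
    rewrite -exprMn ler_pXn2r ?nnegrE ?entrynorm_ge0 ?mulr_ge0 ?frobnorm_ge0//.
    exact: entrynorm_le_frobnorm.
  rewrite /h -mulrA mulrCA -mulrA -mulrDr ler_wpM2l//.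
  by rewrite (le_trans wF)// lerD2l.
have intG i j : cintegrable mu D (fun x => G x i j).
  apply: (@ae_le_cintegrable _ _ _ _ _ mD _ h) => //.
    apply: mxmeasurableZ; first exact: cmeasurable_conj.
    by do 2 (apply: mxmeasurableM => //; try exact: mxmeasurable_adj).
  apply: filterS abound => x ab Dx; rewrite (le_trans (le_entrynorm_entry _ _ _))//.
  rewrite entrynormZ normc_conj; apply: le_trans (h_bound x).
  apply: (@le_trans _ _ (k * w x * entrynorm (F X x))); last first.
    rewrite -[leLHS]mul1r ler_wpM2r ?mulr_ge0 ?entrynorm_ge0//.
    by rewrite ler1n.
  apply: (@le_trans _ _ (normc (a x) * entrynorm (U x) * entrynorm (V x)
      * entrynorm (F X x))).
    rewrite -!mulrA ler_wpM2l ?normc_ge0// (le_trans (entrynormM _ _))//.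
    rewrite entrynorm_adj [X in _ <= _ * X]mulrC mulrA.
    rewrite ler_wpM2r ?entrynorm_ge0// (le_trans (entrynormM _ _))//.
    by rewrite entrynorm_adj.
  by rewrite ler_wpM2r ?entrynorm_ge0// ab.
pose g x := 1 * h x + (k * (1 + d0)) ^+ 2 * w x ^+ 2.
have intg : mu.-integrable D (EFin \o g) by exact: integrable_linear.
apply: (@is_conj_gradient_Re _ _ _ _ _ _
  (\int[mu]_(x in D) `|g x|) d0) => //; first exact: Rintegral_ge0.
move=> Z Zd0; have t0 := entrynorm_ge0 Z.
pose rem x := frobnorm (F (X + Z) x) ^+ 2 - frobnorm (F X x) ^+ 2
  - 2 * complex.Re (frobdot (G x) Z).
have mrem : measurable_fun D rem.
  apply: measurable_funB.
    by apply: measurable_funB; exact: measurable_sqr_frobnorm.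
  apply: measurable_funM => //; apply/measurable_EFinP.
  by apply: (measurable_int mu); exact: integrable_Re_frobdot.
have remg : {ae mu, forall x, D x -> `|rem x| <= entrynorm Z ^+ 2 * g x}.
  apply: filterS2 abound (remainder Z Zd0) => x ab rb Dx.
  move: (ab Dx) (rb Dx) => {}ab {}rb.
  set Y := F (X + Z) x - F X x in rb.
  set L := a x *: (U x *m Z *m V x) in rb.
  have -> : rem x = frobnorm (F X x + Y) ^+ 2 - frobnorm (F X x) ^+ 2
      - 2 * complex.Re (frobdot L (F X x)).
    by rewrite [F X x + Y]addrC subrK /rem Re_frobdotC -frobdot_adj.
  rewrite (le_trans (sqr_frobnorm_expansion _ _ _))//.
  have NL : entrynorm L <= k * w x * entrynorm Z.
    rewrite entrynormZ.
    apply: (@le_trans _ _ (normc (a x) * entrynorm (U x) * entrynorm (V x)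
        * entrynorm Z)); last by rewrite ler_wpM2r.
    rewrite -!mulrA ler_wpM2l ?normc_ge0// (le_trans (entrynormM _ _))//.
    rewrite [X in _ <= _ * X]mulrC mulrA ler_wpM2r ?entrynorm_ge0//.
    exact: entrynormM.
  have NY : entrynorm Y <= entrynorm Z * (k * (1 + d0) * w x).
    rewrite -[Y](subrK L) (le_trans (entrynormD _ _))// (le_trans (lerD rb NL))//.
    have := ltW Zd0; have := mulr_ge0 k0 (w0 x); move: (entrynorm Z) t0 => t t0 kw td0.
    have -> : k * w x * t ^+ 2 + k * w x * t = t * (k * w x) * (1 + t) by ring.
    have -> : t * (k * (1 + d0) * w x) = t * (k * w x) * (1 + d0) by ring.
    by rewrite ler_wpM2l ?mulr_ge0// lerD2l.
  rewrite /g mul1r mulrDr -exprMn -[X in _ <= _ + X]exprMn lerD//.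
    rewrite (@le_trans _ _ (entrynorm Z ^+ 2 * (2 * (k * w x * entrynorm (F X x)))))//.
      rewrite [leRHS]mulrCA ler_wpM2l// [leRHS]mulrA ler_wpM2r ?entrynorm_ge0//.
      by rewrite mulrC.
    by rewrite ler_wpM2l ?sqr_ge0.
  rewrite ler_pXn2r ?nnegrE ?entrynorm_ge0// ?mulr_ge0// ?addr_ge0// ltW//.
have intrem : mu.-integrable D (EFin \o rem).
  apply: (ae_le_integrable mD mrem _ remg).
  by apply: (eq_integrable mD _ _ _ (integrableZl mD (entrynorm Z ^+ 2) intg)) => x _.
have int2 := integrable_Re_frobdot mD Z intG.
have intFZ : mu.-integrable D (EFin \o (fun x => frobnorm (F (X + Z) x) ^+ 2)).
  apply: (eq_integrable mD _ _ _ (integrableD mD intrem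
    (integrable_linear mD 1 2 intF int2))) => x _ /=.
  by rewrite -EFinD; congr (_%:E); rewrite /rem; ring.
rewrite (Re_frobdot_mxintegral mD Z intG) -RintegralZl// -RintegralB//.
rewrite -RintegralB//; last first.
- by apply: (eq_integrable mD _ _ _ (integrableZl mD 2 int2)) => x _.
- by apply: (eq_integrable mD _ _ _ (integrableB mD intFZ intF)) => x _.
have intZg : mu.-integrable D (EFin \o (fun x => entrynorm Z ^+ 2 * g x)).
  by apply: (eq_integrable mD _ _ _ (integrableZl mD (entrynorm Z ^+ 2) intg)) => x _.
rewrite (le_trans (ae_le_normr_Rintegral mD mrem intZg remg))//.
under eq_Rintegral do rewrite normrM (ger0_norm (sqr_ge0 _)).
by rewrite RintegralZl 1?mulrC//; exact: integrable_norm.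
Qed.

End mean_square.

(** * Perturbation of the inverse matrix *)

Section invmx_expansion.
Context {F : comUnitRingType} {n : nat}.
Implicit Types M E : 'M[F]_n.

Lemma invmxD1 M E : M \in unitmx -> M + E \in unitmx ->
  invmx (M + E) = invmx M - invmx M *m E *m invmx (M + E).
Proof.
move=> uM uME; apply: (can_inj (mulKmx uM)).
rewrite mulmxBr !mulmxA mulmxV// mul1mx; apply/eqP; rewrite eq_sym subr_eq.
by rewrite -mulmxDl mulmxV.
Qed.

Lemma invmxD1r M E : M \in unitmx -> M + E \in unitmx ->
  invmx (M + E) = invmx M - invmx (M + E) *m E *m invmx M.
Proof.
move=> uM uME; apply: (can_inj (mulmxK uM)).
rewrite mulmxBl mulVmx// mulmxKV//; apply/eqP; rewrite eq_sym subr_eq.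
by rewrite -mulmxDr mulVmx.
Qed.

(** The two resolvent identities combined: the second-order term contains
    the perturbed inverse between two factors E, so it only needs a bound on
    that inverse. *)
Lemma invmxD2 M E : M \in unitmx -> M + E \in unitmx ->
  invmx (M + E) = invmx M - invmx M *m E *m invmx M
    + invmx M *m E *m invmx (M + E) *m E *m invmx M.
Proof.
move=> uM uME; rewrite {1}invmxD1// {1}invmxD1r// mulmxBr opprB !mulmxA.
by rewrite addrA addrAC.
Qed.

Lemma mulmx_invmxD2 m q (C : 'M[F]_(m, n)) (B : 'M[F]_(n, q)) M E :
  M \in unitmx -> M + E \in unitmx ->
  C *m (invmx (M + E) *m B) = C *m (invmx M *m B)
    - C *m invmx M *m E *m (invmx M *m B)
    + C *m (invmx M *m E *m invmx (M + E) *m E *m invmx M) *m B.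
Proof.
move=> uM uME; rewrite [in LHS]invmxD2//.
move: (invmx (M + E)) (invmx M) => J I.
by rewrite mulmxDl mulmxBl mulmxDr mulmxBr !mulmxA.
Qed.

End invmx_expansion.

Section invmx_perturbation.
Context {R : realType} {n : nat}.
Implicit Types M E : 'M[R[i]]_n.

(** A row vector v in the kernel of M + E satisfies v = - v E M^-1, so its norm
    is at most half of itself. *)
Lemma unitmx_perturb M E : M \in unitmx ->
  entrynorm (invmx M) * entrynorm E <= 2^-1 -> M + E \in unitmx.
Proof.
move=> uM ME; rewrite -row_free_unit; apply: inj_row_free => v vME.
have v_def : v = - (v *m E *m invmx M).
  have /(congr1 (mulmx^~ (invmx M))) : v *m M = - (v *m E).
    by apply/eqP; rewrite -addr_eq0 -mulmxDr vME.
  by rewrite mulmxK// mulNmx.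
apply: entrynorm_eq0; have v0 := entrynorm_ge0 v.
have : entrynorm v <= entrynorm v * 2^-1.
  rewrite {1}v_def entrynormN -mulmxA (le_trans (entrynormM _ _))// ler_wpM2l//.
  by rewrite (le_trans (entrynormM _ _))// mulrC.
by lra.
Qed.

(** From invmxD1, |(M + E)^-1| <= |M^-1| + |(M + E)^-1| / 2. *)
Lemma entrynorm_invmx_perturb M E : M \in unitmx ->
  entrynorm (invmx M) * entrynorm E <= 2^-1 ->
  entrynorm (invmx (M + E)) <= 2 * entrynorm (invmx M).
Proof.
move=> uM ME; have uME := unitmx_perturb uM ME.
have J0 := entrynorm_ge0 (invmx (M + E)).
suff : entrynorm (invmx (M + E)) <=
    entrynorm (invmx M) + entrynorm (invmx (M + E)) * 2^-1 by lra.
rewrite {1}invmxD1// (le_trans (entrynormB _ _))// lerD2l.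
rewrite (le_trans (entrynormM _ _))// mulrC ler_wpM2l//.
by rewrite (le_trans (entrynormM _ _)).
Qed.

End invmx_perturbation.

(** * Structured reduced-order models *)

Section sepform.
Context {R : realType} {d : measure_display} {T : measurableType d}.

Lemma upd_id (I : eqType) (S : Type) (f : I -> S) i :
  [eta f with i |-> f i] = f :> (I -> S).
Proof. by apply/funext => j /=; case: eqP => // ->. Qed.

Lemma sepform_upd q m n (c : 'I_q -> T -> R[i]) (M : 'I_q -> 'M[R[i]]_(m, n))
    (i : 'I_q) (Z : 'M[R[i]]_(m, n)) p :
  sepform c [eta M with i |-> M i + Z] p = sepform c M p + c i p *: Z.
Proof.
rewrite /sepform (bigD1 i)//= eqxx [in RHS](bigD1 i)//= scalerDr -!addrA.
congr (_ + _); rewrite addrC; congr (_ + _).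
by apply: eq_bigr => j /negbTE ->.
Qed.

Lemma entrynorm_sepform q m n (c : 'I_q -> T -> R[i])
    (M : 'I_q -> 'M[R[i]]_(m, n)) p :
  entrynorm (sepform c M p) <=
  (\sum_(i < q) normc (c i p)) * \sum_(i < q) entrynorm (M i).
Proof.
rewrite (le_trans (entrynorm_sum _ _))// mulr_suml; apply: ler_sum => i _.
rewrite entrynormZ ler_wpM2l ?normc_ge0// (bigD1 i)//= lerDl.
by apply: sumr_ge0 => j _; exact: entrynorm_ge0.
Qed.

Lemma mxmeasurable_sepform (D : set T) q m n (c : 'I_q -> T -> R[i])
    (M : 'I_q -> 'M[R[i]]_(m, n)) :
  (forall i, cmeasurable_fun D (c i)) -> mxmeasurable D (sepform c M).
Proof.
move=> mc; apply: mxmeasurable_sum => i.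
by apply: mxmeasurableZ => //; exact: mxmeasurable_cst.
Qed.

End sepform.

Section strom_gradients.
Context {R : realType} {d : measure_display} {T : measurableType d}.
Context {no ni r qA qB qC : nat}.
Variables (mu : {measure set T -> \bar R}) (P : set T).
Hypothesis mP : measurable P.
Variable H : T -> 'M[R[i]]_(no, ni).
Hypothesis H_L2 : mxL2 mu P H.
Variables (alpha : 'I_qA -> T -> R[i]) (beta : 'I_qB -> T -> R[i]).
Variable gamma : 'I_qC -> T -> R[i].
Hypothesis malpha : forall i, cmeasurable_fun P (alpha i).
Hypothesis mbeta : forall j, cmeasurable_fun P (beta j).
Hypothesis mgamma : forall k, cmeasurable_fun P (gamma k).

Let asum p := \sum_(i < qA) normc (alpha i p).
Let bsum p := \sum_(j < qB) normc (beta j p).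
Let csum p := \sum_(k < qC) normc (gamma k p).
Let w p := bsum p * csum p / asum p.

Hypothesis w_L2 : (\int[mu]_(p in P) (w p ^+ 2)%:E < +oo)%E.

Let asum_ge0 p : 0 <= asum p.
Proof. by apply: sumr_ge0 => i _; exact: normc_ge0. Qed.

Let bsum_ge0 p : 0 <= bsum p.
Proof. by apply: sumr_ge0 => i _; exact: normc_ge0. Qed.

Let csum_ge0 p : 0 <= csum p.
Proof. by apply: sumr_ge0 => i _; exact: normc_ge0. Qed.

Let w_ge0 p : 0 <= w p.
Proof. by rewrite divr_ge0// mulr_ge0. Qed.

Let integrable_w2 : mu.-integrable P (EFin \o (fun p => w p ^+ 2)).
Proof.
apply/integrableP; split.
  apply/measurable_EFinP/measurable_funX/measurable_funM.
    by apply: measurable_funM; apply: measurable_sum => i; exact: measurable_normc.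
  apply: measurable_ge0_inv => //.
  by apply: measurable_sum => i; exact: measurable_normc.
by under eq_integral => p _ do rewrite /= ger0_norm ?sqr_ge0//.
Qed.

Variables (A : 'I_qA -> 'M[R[i]]_r) (B : 'I_qB -> 'M[R[i]]_(r, ni)).
Variable C : 'I_qC -> 'M[R[i]]_(no, r).

Let AA := sepform alpha A.
Let BB := sepform beta B.
Let CC := sepform gamma C.

Lemma mxmeasurable_state (A' : 'I_qA -> 'M[R[i]]_r)
    (B' : 'I_qB -> 'M[R[i]]_(r, ni)) : mxmeasurable P (state alpha beta A' B').
Proof.
apply: mxmeasurableM; last exact: mxmeasurable_sepform.
by apply: mxmeasurable_inv; exact: mxmeasurable_sepform.
Qed.

Lemma mxmeasurable_residual (A' : 'I_qA -> 'M[R[i]]_r)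
    (B' : 'I_qB -> 'M[R[i]]_(r, ni)) (C' : 'I_qC -> 'M[R[i]]_(no, r)) :
  mxmeasurable P (fun p => H p - output alpha beta gamma A' B' C' p).
Proof.
apply: mxmeasurableB; first by case: H_L2.
by apply: mxmeasurableM; [exact: mxmeasurable_sepform|exact: mxmeasurable_state].
Qed.

Hypothesis A_Sigma : Sigma_St mu P alpha A.

(** Finitely many essential bounds hold simultaneously outside one null set, and
    may therefore be added up over i. *)
Lemma Sigma_St_bound : exists2 K : R, 0 <= K &
  {ae mu, forall p, P p ->
    AA p \in unitmx /\ asum p * entrynorm (invmx (AA p)) <= K}.
Proof.
case: A_Sigma => ae_unit ess.
have /choice[M aeM] : forall i, exists M : R, {ae mu, forall p, P p ->
    normc (alpha i p) * entrynorm (invmx (AA p)) <= M}.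
  move=> i; have [M ltM] : exists M : R, (ess_sup mu
      ((fun p => (frobnorm (alpha i p *: invmx (AA p)))%:E) \_ P) <= M%:E)%E.
    have := ess i; case: (ess_sup _ _) => [M _||_]; first by exists M.
      by rewrite ltxx.
    by exists 0; rewrite leNye.
  exists ((r * r)%:R * M); move/ess_supP : ltM; apply: filterS => p /=.
  rewrite /patch => + Pp; rewrite mem_set// lee_fin => ltM.
  rewrite -entrynormZ (le_trans (entrynorm_le_frobnorm _))//.
  by rewrite ler_wpM2l.
have M0 : 0 <= \sum_(i < qA) `|M i| by apply: sumr_ge0.
exists (\sum_(i < qA) `|M i|) => //.
have aeall : {ae mu, forall p, forall i, P p ->
    normc (alpha i p) * entrynorm (invmx (AA p)) <= M i}.
  exact: filter_forall.
apply: filterS2 ae_unit aeall => p up pM Pp; split; first exact: up.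
rewrite mulr_suml; apply: ler_sum => i _.
by rewrite (le_trans (pM i Pp))// ler_norm.
Qed.

(** Up to the constants of the model, the resolvent bound says that
    |A(p)^-1| <= K / sum |alpha_i(p)|, so that the product of the three factors
    of the output is controlled by the weight w. *)
Lemma Sigma_St_bounds : exists K k1 kB kC : R,
  [/\ 0 <= K, 0 <= k1, 0 <= kB, 0 <= kC &
  {ae mu, forall p, P p -> [/\ AA p \in unitmx,
    asum p * entrynorm (invmx (AA p)) <= K,
    entrynorm (CC p) * entrynorm (invmx (AA p)) * entrynorm (BB p) <= k1 * w p,
    bsum p * (entrynorm (CC p) * entrynorm (invmx (AA p))) <= kB * w p &
    csum p * (entrynorm (invmx (AA p)) * entrynorm (BB p)) <= kC * w p]}].
Proof.
have [K K0 aeK] := Sigma_St_bound.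
pose SB := \sum_(j < qB) entrynorm (B j).
pose SC := \sum_(k < qC) entrynorm (C k).
have SB0 : 0 <= SB by apply: sumr_ge0 => j _; exact: entrynorm_ge0.
have SC0 : 0 <= SC by apply: sumr_ge0 => j _; exact: entrynorm_ge0.
exists K, (SC * K * SB), (SC * K), (K * SB); split; rewrite ?mulr_ge0//.
apply: filterS aeK => p + Pp => /(_ Pp)[uA aK].
have leB : entrynorm (BB p) <= bsum p * SB by exact: entrynorm_sepform.
have leC : entrynorm (CC p) <= csum p * SC by exact: entrynorm_sepform.
have B0 := entrynorm_ge0 (BB p); have C0 := entrynorm_ge0 (CC p).
have I0 := entrynorm_ge0 (invmx (AA p)).
(* Where all the alpha_i vanish, A(p) = 0 is invertible only in dimension 0, and
   then its inverse has norm 0; this matches 1 / 0 = 0. *)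
have leI : entrynorm (invmx (AA p)) <= K * (asum p)^-1.
  have [a0|a_neq0] := eqVneq (asum p) 0; last first.
    by rewrite ler_pdivlMr ?lt_def ?a_neq0 ?asum_ge0// mulrC.
  have A0 : AA p = 0.
    apply: entrynorm_eq0; apply: le_trans (entrynorm_sepform _ _ _) _.
    by rewrite -/(asum p) a0 mul0r.
  by rewrite -[invmx _](mulmxKV uA) A0 mulmx0 entrynorm0 a0 invr0 mulr0.
have V0 : 0 <= (asum p)^-1 by rewrite invr_ge0.
split => //.
- rewrite [leRHS](_ : _ = csum p * SC * (K * (asum p)^-1) * (bsum p * SB)).
    by do 2 (apply: ler_pM => //; rewrite ?mulr_ge0//).
  by rewrite /w; ring.
- rewrite [leRHS](_ : _ = bsum p * (csum p * SC * (K * (asum p)^-1))).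
    by rewrite ler_wpM2l// ler_pM.
  by rewrite /w; ring.
- rewrite [leRHS](_ : _ = csum p * (K * (asum p)^-1 * (bsum p * SB))).
    by rewrite ler_wpM2l// ler_pM.
  by rewrite /w; ring.
Qed.

Let residual p := H p - output alpha beta gamma A B C p.

(** The output is bounded by a multiple of w, and H is square-integrable. *)
Lemma integrable_residual :
  mu.-integrable P (EFin \o (fun p => frobnorm (residual p) ^+ 2)).
Proof.
have [K [k1 [kB [kC [K0 k10 _ _ aeb]]]]] := Sigma_St_bounds.
pose c : R := (no * ni)%:R.
have intH : mu.-integrable P (EFin \o (fun p => frobnorm (H p) ^+ 2)).
  case: H_L2 => mH intH; apply/integrableP; split.
    by apply/measurable_EFinP; exact: measurable_sqr_frobnorm.
  by under eq_integral => p _ do rewrite /= ger0_norm ?sqr_ge0//.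
apply: (ae_le_integrable mP _
  (integrable_linear mP (2 * c ^+ 2) (2 * k1 ^+ 2) intH integrable_w2)).
  by apply: measurable_sqr_frobnorm; exact: mxmeasurable_residual.
apply: filterS aeb => p + Pp => /(_ Pp)[_ _ leo _ _].
rewrite ger0_norm ?sqr_ge0//.
have leHH : entrynorm (H p) <= c * frobnorm (H p) by exact: entrynorm_le_frobnorm.
have leout : entrynorm (output alpha beta gamma A B C p) <= k1 * w p.
  apply: le_trans leo; rewrite /output /state mulmxA.
  rewrite (le_trans (entrynormM _ _))// ler_wpM2r ?entrynorm_ge0//.
  exact: entrynormM.
have les : frobnorm (residual p) <= c * frobnorm (H p) + k1 * w p.
  rewrite (le_trans (frobnorm_le_entrynorm _))// (le_trans (entrynormB _ _))//.
  by rewrite lerD.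
have les0 : 0 <= c * frobnorm (H p) + k1 * w p.
  by rewrite (le_trans (frobnorm_ge0 _) les).
apply: (@le_trans _ _ ((c * frobnorm (H p) + k1 * w p) ^+ 2)).
  by rewrite ler_pXn2r ?nnegrE ?frobnorm_ge0.
rewrite -subr_ge0; have := sqr_ge0 (c * frobnorm (H p) - k1 * w p).
by congr (0 <= _); ring.
Qed.

(** The only case with a remainder, C M^-1 E (M + E)^-1 E M^-1 B for M = A(p)
    and E = alpha_i(p) Z; its norm is at most 2 K^2 |Z|^2 |C| |M^-1| |B|. *)
Lemma is_conj_gradient_A (i : 'I_qA) :
  is_conj_gradient
    (fun Z => objective mu P H alpha beta gamma [eta A with i |-> Z] B C)
    (A i)
    (mxintegral mu P (fun p => (alpha i p)^* *:
       (dual_state alpha gamma A C p *m residual p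
        *m (state alpha beta A B p) ^t*))).
Proof.
have [K [k1 [kB [kC [K0 k10 _ _ aeb]]]]] := Sigma_St_bounds.
pose F Z p := H p - output alpha beta gamma [eta A with i |-> Z] B C p.
have FA p : F (A i) p = residual p by rewrite /F upd_id.
have -> : (fun p => (alpha i p)^* *: (dual_state alpha gamma A C p
    *m residual p *m (state alpha beta A B p) ^t*)) =
  (fun p => (alpha i p)^* *: ((CC p *m invmx (AA p)) ^t* *m F (A i) p
    *m (state alpha beta A B p) ^t*)).
  by apply/funext => p; rewrite FA adj_mulmx.
have ale p : normc (alpha i p) <= asum p.
  rewrite /asum (bigD1 i)//= lerDl.
  by apply: sumr_ge0 => j _; exact: normc_ge0.
(* The linear part is bounded by K k1 w and the remainder by 2 K^2 k1 w; the
   radius is chosen so that K |Z| <= 1 / 2. *)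
apply: (@is_conj_gradient_mean_square _ _ _ _ _ mP _ _ _ _ F (A i) (alpha i)
  (fun p => CC p *m invmx (AA p)) (state alpha beta A B) w
  ((K + 2 * K ^+ 2) * k1) (2 * (K + 1))^-1) => //.
- by rewrite mulr_ge0// addr_ge0// mulr_ge0// sqr_ge0.
- by rewrite invr_gt0 mulr_gt0// ltr_wpDl.
- by move=> Z; exact: mxmeasurable_residual.
- apply: mxmeasurableM; first exact: mxmeasurable_sepform.
  by apply: mxmeasurable_inv; exact: mxmeasurable_sepform.
- exact: mxmeasurable_state.
- by under eq_fun do rewrite FA; exact: integrable_residual.
- apply: filterS aeb => p + Pp => /(_ Pp)[_ aK lek _ _].
  have I0 := entrynorm_ge0 (invmx (AA p)).
  apply: (@le_trans _ _ (asum p * entrynorm (invmx (AA p)) *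
      (entrynorm (CC p) * entrynorm (invmx (AA p)) * entrynorm (BB p)))).
    rewrite [leRHS](_ : _ = asum p * (entrynorm (CC p) * entrynorm (invmx (AA p)))
      * (entrynorm (invmx (AA p)) * entrynorm (BB p))); last by ring.
    apply: ler_pM; rewrite ?mulr_ge0 ?normc_ge0 ?entrynorm_ge0 ?entrynormM//.
    by apply: ler_pM; rewrite ?normc_ge0 ?entrynorm_ge0 ?entrynormM.
  apply: (@le_trans _ _ (K * (k1 * w p))).
    by apply: ler_pM; rewrite ?mulr_ge0 ?entrynorm_ge0.
  rewrite mulrA ler_wpM2r// ler_wpM2r// lerDl mulr_ge0// sqr_ge0//.
move=> Z Zd0; apply: filterS aeb => p + Pp => /(_ Pp)[uA aK lek _ _].
have I0 := entrynorm_ge0 (invmx (AA p)); have t0 := entrynorm_ge0 Z.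
have aI : normc (alpha i p) * entrynorm (invmx (AA p)) <= K.
  by rewrite (le_trans _ aK)// ler_wpM2r.
pose E := alpha i p *: Z.
have IE : entrynorm (invmx (AA p)) * entrynorm E <= 2^-1.
  rewrite entrynormZ mulrA [X in X * _]mulrC.
  apply: (@le_trans _ _ (K * entrynorm Z)); first by rewrite ler_wpM2r.
  move: Zd0; rewrite -div1r ltr_pdivlMr ?mulr_gt0 ?ltr_wpDl// => Zd0.
  have : entrynorm Z * (2 * (K + 1)) = 2 * (K * entrynorm Z) + 2 * entrynorm Z.
    by ring.
  by lra.
have uE := unitmx_perturb uA IE.
have leJ := entrynorm_invmx_perturb uA IE.
rewrite FA /F /residual /output /state sepform_upd -/(AA p) -/(BB p) -/(CC p) -/E.
have -> : H p - CC p *m (invmx (AA p + E) *m BB p)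
    - (H p - CC p *m (invmx (AA p) *m BB p))
    - alpha i p *: (CC p *m invmx (AA p) *m Z *m (invmx (AA p) *m BB p))
  = - (CC p *m (invmx (AA p) *m E *m invmx (AA p + E) *m E *m invmx (AA p)) *m BB p).
  have -> : alpha i p *: (CC p *m invmx (AA p) *m Z *m (invmx (AA p) *m BB p))
      = CC p *m invmx (AA p) *m E *m (invmx (AA p) *m BB p).
    by rewrite /E -scalemxAr -scalemxAl.
  rewrite mulmx_invmxD2//.
  move: (_ *m _ *m BB p) (_ *m (invmx (AA p) *m BB p)) => z y.
  move: (CC p *m _) => x.
  by apply/matrixP => k l; rewrite !mxE; ring.
rewrite entrynormN.
apply: (@le_trans _ _ (entrynorm (CC p) * (entrynorm (invmx (AA p)) * entrynorm E
    * (2 * entrynorm (invmx (AA p))) * entrynorm E * entrynorm (invmx (AA p)))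
    * entrynorm (BB p))).
  by do !apply: entrynormM_le => //.
rewrite entrynormZ.
have aI2 : (normc (alpha i p) * entrynorm (invmx (AA p))) ^+ 2 <= K ^+ 2.
  by rewrite ler_pXn2r// nnegrE ?mulr_ge0 ?normc_ge0.
apply: (@le_trans _ _ (2 * (K ^+ 2 * (k1 * w p)) * entrynorm Z ^+ 2)).
  rewrite [leLHS](_ : _ = 2 * ((normc (alpha i p) * entrynorm (invmx (AA p))) ^+ 2
    * (entrynorm (CC p) * entrynorm (invmx (AA p)) * entrynorm (BB p)))
    * entrynorm Z ^+ 2); last by ring.
  rewrite ler_wpM2r ?sqr_ge0// ler_wpM2l// ler_pM ?sqr_ge0//.
  by rewrite !mulr_ge0 ?entrynorm_ge0.
rewrite ler_wpM2r ?sqr_ge0// -subr_ge0.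
rewrite (_ : _ - _ = K * (k1 * w p)); last by ring.
by rewrite mulr_ge0// mulr_ge0.
Qed.

(** The residual is affine in the coefficient of B, with linear part
    - beta_j C(p) A(p)^-1 Z; hence V is the identity matrix. *)
Lemma is_conj_gradient_B (j : 'I_qB) :
  is_conj_gradient
    (fun Z => objective mu P H alpha beta gamma A [eta B with j |-> Z] C)
    (B j)
    (mxintegral mu P (fun p => (beta j p)^* *:
       (dual_state alpha gamma A C p *m (output alpha beta gamma A B C p - H p)))).
Proof.
have [K [k1 [kB [kC [K0 k10 kB0 _ aeb]]]]] := Sigma_St_bounds.
pose F Z p := H p - output alpha beta gamma A [eta B with j |-> Z] C p.
have FB p : F (B j) p = residual p by rewrite /F upd_id.
have -> : (fun p => (beta j p)^* *: (dual_state alpha gamma A C p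
    *m (output alpha beta gamma A B C p - H p))) =
  (fun p => (- beta j p)^* *: ((CC p *m invmx (AA p)) ^t* *m F (B j) p
    *m (1%:M : 'M[R[i]]_ni) ^t*)).
  apply/funext => p; rewrite FB adj_mulmx trmx1 map_mx1 mulmx1.
  by rewrite rmorphN scaleNr -scalerN -mulmxN opprB.
apply: (@is_conj_gradient_mean_square _ _ _ _ _ mP _ _ _ _ F (B j)
  (fun p => - beta j p) (fun p => CC p *m invmx (AA p)) (fun=> 1%:M) w
  (kB * entrynorm (1%:M : 'M[R[i]]_ni)) 1) => //.
- by rewrite mulr_ge0// entrynorm_ge0.
- by move=> Z; exact: mxmeasurable_residual.
- exact: cmeasurableN.
- apply: mxmeasurableM; first exact: mxmeasurable_sepform.
  by apply: mxmeasurable_inv; exact: mxmeasurable_sepform.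
- by under eq_fun do rewrite FB; exact: integrable_residual.
- apply: filterS aeb => p + Pp => /(_ Pp)[_ _ _ leB _].
  rewrite [leRHS]mulrAC ler_wpM2r ?entrynorm_ge0//; apply: le_trans leB.
  rewrite normcN ler_pM ?normc_ge0 ?entrynorm_ge0 ?entrynormM//.
  by rewrite /bsum (bigD1 j)//= lerDl sumr_ge0// => l _; exact: normc_ge0.
move=> Z _; apply: nearW => p _.
rewrite FB /F /residual /output /state sepform_upd -/(AA p) -/(BB p) -/(CC p).
rewrite (_ : _ - _ - _ = 0).
  by rewrite entrynorm0 mulr_ge0 ?sqr_ge0// mulr_ge0// mulr_ge0 ?entrynorm_ge0.
rewrite mulmx1 scaleNr opprK !mulmxDr !mulmxA -!scalemxAr.
move: (CC p *m _ *m Z) (CC p *m _ *m BB p) => x y.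
by apply/matrixP => k l; rewrite !mxE; ring.
Qed.

(** The residual is affine in the coefficient of C, with linear part
    - gamma_k Z X(p); hence U is the identity matrix. *)
Lemma is_conj_gradient_C (k : 'I_qC) :
  is_conj_gradient
    (fun Z => objective mu P H alpha beta gamma A B [eta C with k |-> Z])
    (C k)
    (mxintegral mu P (fun p => (gamma k p)^* *:
       ((output alpha beta gamma A B C p - H p) *m (state alpha beta A B p) ^t*))).
Proof.
have [K [k1 [kB [kC [K0 k10 _ kC0 aeb]]]]] := Sigma_St_bounds.
pose F Z p := H p - output alpha beta gamma A B [eta C with k |-> Z] p.
have FC p : F (C k) p = residual p by rewrite /F upd_id.
have -> : (fun p => (gamma k p)^* *: ((output alpha beta gamma A B C p - H p)
    *m (state alpha beta A B p) ^t*)) =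
  (fun p => (- gamma k p)^* *: ((1%:M : 'M[R[i]]_no) ^t* *m F (C k) p
    *m (state alpha beta A B p) ^t*)).
  apply/funext => p; rewrite FC trmx1 map_mx1 mul1mx.
  by rewrite rmorphN scaleNr -scalerN -mulNmx opprB.
apply: (@is_conj_gradient_mean_square _ _ _ _ _ mP _ _ _ _ F (C k)
  (fun p => - gamma k p) (fun=> 1%:M) (state alpha beta A B) w
  (kC * entrynorm (1%:M : 'M[R[i]]_no)) 1) => //.
- by rewrite mulr_ge0// entrynorm_ge0.
- by move=> Z; exact: mxmeasurable_residual.
- exact: cmeasurableN.
- exact: mxmeasurable_state.
- by under eq_fun do rewrite FC; exact: integrable_residual.
- apply: filterS aeb => p + Pp => /(_ Pp)[_ _ _ _ leC].
  rewrite mulrAC [leRHS]mulrAC ler_wpM2r ?entrynorm_ge0//; apply: le_trans leC.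
  rewrite normcN ler_pM ?normc_ge0 ?entrynorm_ge0 ?entrynormM//.
  by rewrite /csum (bigD1 k)//= lerDl sumr_ge0// => l _; exact: normc_ge0.
move=> Z _; apply: nearW => p _.
rewrite FC /F /residual /output sepform_upd -/(CC p).
rewrite (_ : _ - _ - _ = 0).
  by rewrite entrynorm0 mulr_ge0 ?sqr_ge0// mulr_ge0// mulr_ge0 ?entrynorm_ge0.
rewrite mul1mx scaleNr opprK mulmxDl -scalemxAl.
move: (Z *m _) (CC p *m _) => x y.
by apply/matrixP => l m; rewrite !mxE; ring.
Qed.

End strom_gradients.

(** * The gradients of the objective *)

Theorem theorem2p1 (R : realType) (np no ni r qA qB qC : nat)
  (hnp : (0 < np)%N) (hno : (0 < no)%N) (hni : (0 < ni)%N) (hr : (0 < r)%N)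
  (hqA : (0 < qA)%N) (hqB : (0 < qB)%N) (hqC : (0 < qC)%N)
  (S : set (set (cspace R np)))
  (P : set (g_sigma_algebraType S)) (mP : measurable P)
  (mu : {measure set (g_sigma_algebraType S) -> \bar R})
  (H : g_sigma_algebraType S -> 'M[R[i]]_(no, ni)) (hH : mxL2 mu P H)
  (alpha : 'I_qA -> g_sigma_algebraType S -> R[i])
  (beta : 'I_qB -> g_sigma_algebraType S -> R[i])
  (gamma : 'I_qC -> g_sigma_algebraType S -> R[i])
  (malpha : forall i, cmeasurable_fun P (alpha i))
  (mbeta : forall j, cmeasurable_fun P (beta j))
  (mgamma : forall k, cmeasurable_fun P (gamma k))
  (hint : (\int[mu]_(p in P)
     (((\sum_(j < qB) normc (beta j p)) * (\sum_(k < qC) normc (gamma k p))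
        / (\sum_(i < qA) normc (alpha i p))) ^+ 2)%:E < +oo)%E)
  (A : 'I_qA -> 'M[R[i]]_r) (B : 'I_qB -> 'M[R[i]]_(r, ni))
  (C : 'I_qC -> 'M[R[i]]_(no, r))
  (hSt : Sigma_St mu P alpha A) :
  [/\ forall i : 'I_qA,
        is_conj_gradient
          (fun Z => objective mu P H alpha beta gamma [eta A with i |-> Z] B C)
          (A i)
          (mxintegral mu P (fun p => (alpha i p)^* *:
             (dual_state alpha gamma A C p
              *m (H p - output alpha beta gamma A B C p)
              *m (state alpha beta A B p) ^t*))),
      forall j : 'I_qB,
        is_conj_gradient
          (fun Z => objective mu P H alpha beta gamma A [eta B with j |-> Z] C)
          (B j)
          (mxintegral mu P (fun p => (beta j p)^* *:
             (dual_state alpha gamma A C p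
              *m (output alpha beta gamma A B C p - H p)))) &
      forall k : 'I_qC,
        is_conj_gradient
          (fun Z => objective mu P H alpha beta gamma A B [eta C with k |-> Z])
          (C k)
          (mxintegral mu P (fun p => (gamma k p)^* *:
             ((output alpha beta gamma A B C p - H p)
              *m (state alpha beta A B p) ^t*)))].
Proof.
split=> l; first exact: is_conj_gradient_A.
  exact: is_conj_gradient_B.
exact: is_conj_gradient_C.
Qed.
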